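(* Let $G,H<\mathrm{Homeo}^+(\mathbf{R})$ be two coherent actions such that the underlying groups $G,H$ are isomorphic. Then for each isomorphism $\nu:G\to H$ there is a homeomorphism $\phi:\mathbf{R}\to\mathbf{R}$ such that $\nu(f)=\phi^{-1}f\phi$ for each $f\in G$.
   Context: $\mathrm{Homeo}^+(\mathbf{R})$ is the group of orientation preserving homeomorphisms of $\mathbf{R}$. Actions are right actions, $x\mapsto x\cdot g$, and products are read accordingly: $x\cdot(fg)=(x\cdot f)\cdot g$. A group action $G<\mathrm{Homeo}^+(\mathbf{R})$ means a subgroup of $\mathrm{Homeo}^+(\mathbf{R})$. An element has trivial germ at $+\infty$ (resp. $-\infty$) if it fixes each point of $(r,\infty)$ (resp. $(-\infty,r)$) for some $r\in\mathbf{R}$. The group of germs of $G$ at $+\infty$ (resp. $-\infty$) is the quotient of $G$ by the normal subgroup of elements with trivial germ at $+\infty$ (resp. $-\infty$). The action $G<\mathrm{Homeo}^+(\mathbf{R})$ is coherent if: (i) it is minimal, i.e. all orbits are dense in $\mathbf{R}$; (ii) the groups of germs at $+\infty$ and at $-\infty$ are solvable; (iii) there exists an element of $G$ that has trivial germ at $-\infty$ and does not fix any point in some interval $(r,\infty)$; (iv) there exists an element of $G$ that has trivial germ at $+\infty$ and does not fix any point in some interval $(-\infty,s)$. *)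

(* Defs.v *)
From HB Require Import structures.
From mathcomp Require Import all_boot all_order all_algebra.
From mathcomp Require Import boolp classical_sets reals topology normedtype.

Set Implicit Arguments.
Unset Strict Implicit.
Unset Printing Implicit Defensive.

Import Order.TTheory GRing.Theory Num.Theory.
Import numFieldNormedType.Exports.

Local Open Scope classical_set_scope.
Local Open Scope ring_scope.

Definition is_homeomorphism (T U : topologicalType) (f : T -> U) : Prop :=
  exists g : U -> T,
    [/\ cancel f g, cancel g f, continuous f & continuous g].

Definition subgroup (T : groupType) (G : groupClosed T) : Type :=
  {x : T | x \in G}.

Section SubgroupGroup.
Variables (T : groupType) (G : groupClosed T).

HB.instance Definition _ := SubChoice.on (subgroup G).

Fact subgroup_closed : group_closed G.
Proof. by split=> [|x y Gx Gy]; [exact: gpred1 | exact: gpredF]. Qed.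

HB.instance Definition _ :=
  SubChoice_isSubGroup.Build T (fun x => x \in G) (subgroup G) subgroup_closed.

End SubgroupGroup.

(* The group of cosets N x of a normal subgroup N. *)

Definition is_normal (T : groupType) (N : {pred T}) : Prop :=
  forall x y : T, x \in N -> (x ^ y)%g \in N.

Section Quotient.
Variables (T : groupType) (N : groupClosed T).
Local Open Scope group_scope.

Definition coset_rel : rel T := fun x y => x / y \in N.

Fact coset_rel_refl : reflexive coset_rel.
Proof. by move=> x; rewrite /coset_rel divgg gpred1. Qed.

Fact coset_rel_sym : symmetric coset_rel.
Proof. by move=> x y; rewrite /coset_rel gpredFC. Qed.

Fact coset_rel_trans : transitive coset_rel.
Proof.
move=> y x z Nxy Nyz; rewrite /coset_rel.
by rewrite -[x](mulgVK y) -mulgA gpredM.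
Qed.

Canonical coset_equiv :=
  EquivRel coset_rel coset_rel_refl coset_rel_sym coset_rel_trans.

Definition quotient_group (nN : is_normal N) : Type := {eq_quot coset_rel}%qT.

Variable nN : is_normal N.
Local Notation Q := (quotient_group nN).
Local Open Scope quotient_scope.

HB.instance Definition _ := Choice.on Q.
HB.instance Definition _ := EqQuotient.on Q.

Definition quotient_one : Q := \pi_Q 1.
Definition quotient_mul (u v : Q) : Q := \pi_Q (repr u * repr v).
Definition quotient_inv (u : Q) : Q := \pi_Q (repr u)^-1.

Lemma quotient_eq (x y : T) : (x / y \in N) <-> \pi_Q x = \pi_Q y.
Proof.
by split=> [Nxy|/eqP]; [apply/eqP; rewrite piE | rewrite piE].
Qed.

Lemma quotient_piM (x y : T) :
  quotient_mul (\pi_Q x) (\pi_Q y) = \pi_Q (x * y).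
Proof.
have /quotient_eq Na : \pi_Q (repr (\pi_Q x)) = \pi_Q x by rewrite reprK.
have /quotient_eq Nb : \pi_Q (repr (\pi_Q y)) = \pi_Q y by rewrite reprK.
apply/quotient_eq.
move: (repr (\pi_Q x)) (repr (\pi_Q y)) Na Nb => c d Na Nb.
have -> : c * d / (x * y) = (c / x) * ((d / y) ^ x^-1).
  by rewrite /conjg invgK invgM !mulgA mulgVK.
by rewrite gpredM// nN.
Qed.

Lemma quotient_piV (x : T) : quotient_inv (\pi_Q x) = \pi_Q x^-1.
Proof.
have /quotient_eq Nx : \pi_Q (repr (\pi_Q x)) = \pi_Q x by rewrite reprK.
apply/quotient_eq; move: (repr _) Nx => c Nc.
have -> : c^-1 / x^-1 = ((c / x)^-1) ^ x.
  by rewrite /conjg invgM !invgK !mulgA mulVg mul1g.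
by rewrite nN// gpredV.
Qed.

Lemma quotient_surj (u : Q) : exists x, u = \pi_Q x.
Proof. by exists (repr u); rewrite reprK. Qed.

Fact quotient_mulgA : associative quotient_mul.
Proof.
move=> u v w; have [[x ->] [y ->] [z ->]] :=
  And3 (quotient_surj u) (quotient_surj v) (quotient_surj w).
by rewrite !quotient_piM mulgA.
Qed.

Fact quotient_mul1g : left_id quotient_one quotient_mul.
Proof.
by move=> u; have [x ->] := quotient_surj u; rewrite quotient_piM mul1g.
Qed.

Fact quotient_mulg1 : right_id quotient_one quotient_mul.
Proof.
by move=> u; have [x ->] := quotient_surj u; rewrite quotient_piM mulg1.
Qed.

Fact quotient_mulVg : left_inverse quotient_one quotient_inv quotient_mul.
Proof.
move=> u; have [x ->] := quotient_surj u.
by rewrite quotient_piV quotient_piM mulVg.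
Qed.

Fact quotient_mulgV : right_inverse quotient_one quotient_inv quotient_mul.
Proof.
move=> u; have [x ->] := quotient_surj u.
by rewrite quotient_piV quotient_piM mulgV.
Qed.

HB.instance Definition _ := isGroup.Build Q quotient_mulgA quotient_mul1g
  quotient_mulg1 quotient_mulVg quotient_mulgV.

End Quotient.

Section Solvable.
Variable T : groupType.
Local Open Scope group_scope.

Definition generated_subgroup (A : set T) : set T :=
  smallest (fun B : set T => group_closed [in B]) A.

Fixpoint derived_series (n : nat) : set T :=
  if n is m.+1 then
    generated_subgroup [set z | exists x y,
      [/\ derived_series m x, derived_series m y & z = [~ x, y]]]
  else setT.

Definition is_solvable : Prop := exists n, derived_series n = [set 1].

End Solvable.

(* Homeomorphisms of the line, with the product of right actions: f * g is f *)
(* followed by g.                                                            *)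

Definition homeo (R : realType) : Type :=
  {f : R -> R | `[< is_homeomorphism f >]}.

Definition homeo_fun (R : realType) (f : homeo R) : R -> R := val f.
Coercion homeo_fun : homeo >-> Funclass.

Section HomeoGroup.
Variable R : realType.
Implicit Types f g : homeo R.

HB.instance Definition _ := SubChoice.on (homeo R).

Lemma homeoP f g : f =1 g <-> f = g.
Proof. by split=> [fg|->//]; apply/val_inj/funext. Qed.

Definition homeo_mk (f : R -> R) (hf : is_homeomorphism f) : homeo R :=
  exist _ f (asboolT hf).

Fact homeo_one_subproof : is_homeomorphism (id : R -> R).
Proof. by exists id; split=> // x; exact: cvg_id. Qed.

Lemma homeo_is_homeomorphism f : is_homeomorphism f.
Proof. exact/asboolP/(valP f). Qed.

Fact homeo_mul_subproof f g : is_homeomorphism (g \o f).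
Proof.
have [f' [fK f'K cf cf']] := homeo_is_homeomorphism f.
have [g' [gK g'K cg cg']] := homeo_is_homeomorphism g.
exists (f' \o g'); split.
- exact: can_comp.
- exact: can_comp.
- by move=> x; apply: continuous_comp; [exact: cf | exact: cg].
- by move=> x; apply: continuous_comp; [exact: cg' | exact: cf'].
Qed.

Fact homeo_inv_exists f : exists g : R -> R, cancel f g /\ cancel g f.
Proof. by have [g [fK gK _ _]] := homeo_is_homeomorphism f; exists g. Qed.

Definition homeo_inv_fun f : R -> R := projT1 (cid (homeo_inv_exists f)).

Fact homeo_inv_funK f :
  cancel f (homeo_inv_fun f) /\ cancel (homeo_inv_fun f) f.
Proof. by rewrite /homeo_inv_fun; case: cid. Qed.

Fact homeo_inv_subproof f : is_homeomorphism (homeo_inv_fun f).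
Proof.
have [fK gK] := homeo_inv_funK f.
have [g [fK' gK' cf cg]] := homeo_is_homeomorphism f.
have -> : homeo_inv_fun f = g.
  by apply/funext => x; rewrite -[LHS]fK' gK.
by exists (f : R -> R).
Qed.

Definition homeo_one : homeo R := homeo_mk homeo_one_subproof.
Definition homeo_mul f g : homeo R := homeo_mk (homeo_mul_subproof f g).
Definition homeo_inv f : homeo R := homeo_mk (homeo_inv_subproof f).

Fact homeo_mulgA : associative homeo_mul.
Proof. by move=> f g h; apply/homeoP. Qed.

Fact homeo_mul1g : left_id homeo_one homeo_mul.
Proof. by move=> f; apply/homeoP. Qed.

Fact homeo_mulg1 : right_id homeo_one homeo_mul.
Proof. by move=> f; apply/homeoP. Qed.

Fact homeo_mulVg : left_inverse homeo_one homeo_inv homeo_mul.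
Proof. by move=> f; apply/homeoP => x; exact: (homeo_inv_funK f).2. Qed.

Fact homeo_mulgV : right_inverse homeo_one homeo_inv homeo_mul.
Proof. by move=> f; apply/homeoP => x; exact: (homeo_inv_funK f).1. Qed.

HB.instance Definition _ := isGroup.Build (homeo R) homeo_mulgA homeo_mul1g
  homeo_mulg1 homeo_mulVg homeo_mulgV.

Lemma homeoME f g x : ((f * g)%g : homeo R) x = g (f x). Proof. by []. Qed.
Lemma homeo1E x : (1%g : homeo R) x = x. Proof. by []. Qed.
Lemma homeoK f : cancel f (f^-1%g : homeo R).
Proof. exact: (homeo_inv_funK f).1. Qed.
Lemma homeoVK f : cancel (f^-1%g : homeo R) f.
Proof. exact: (homeo_inv_funK f).2. Qed.

Definition orientation_preserving : {pred homeo R} :=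
  fun f => `[< {homo f : x y / x < y} >].

Fact increasing_homeoF f g : {homo f : x y / x < y} ->
  {homo g : x y / x < y} -> {homo ((f / g)%g : homeo R) : x y / x < y}.
Proof.
move=> hf hg x y xy; rewrite !homeoME; have {}xy := hf _ _ xy.
rewrite ltNge le_eqVlt; apply/negP => /orP[/eqP e|/hg].
  by move: xy; rewrite -(homeoVK g (f x)) -e homeoVK ltxx.
by rewrite !homeoVK => /(lt_trans xy); rewrite ltxx.
Qed.

Fact orientation_preserving_closed : group_closed orientation_preserving.
Proof.
split=> [|f g /asboolP hf /asboolP hg]; apply/asboolP => //.
exact: increasing_homeoF.
Qed.

HB.instance Definition _ := isMulClosed.Build (homeo R) orientation_preserving
  (group_closedM orientation_preserving_closed).
HB.instance Definition _ := isMul1Closed.Build (homeo R) orientation_preserving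
  orientation_preserving_closed.1.
HB.instance Definition _ := isInvClosed.Build (homeo R) orientation_preserving
  (group_closedV orientation_preserving_closed).

End HomeoGroup.

(* The group Homeo^+(R). *)
Definition homeop (R : realType) : Type :=
  subgroup (orientation_preserving (R := R)).

HB.instance Definition _ (R : realType) := SubGroup.on (homeop R).

Definition homeop_val (R : realType) (f : homeop R) : homeo R := val f.
Coercion homeop_val : homeop >-> homeo.

Section Actions.
Variable R : realType.
Local Open Scope group_scope.

Definition trivial_germ_pinfty (f : homeop R) : Prop :=
  exists r : R, forall x, x \in `]r, +oo[ -> f x = x.

Definition trivial_germ_ninfty (f : homeop R) : Prop :=
  exists r : R, forall x, x \in `]-oo, r[ -> f x = x.

Variable G : groupClosed (homeop R).

Definition subgroup_homeo (f : subgroup G) : homeo R := homeop_val (val f).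

Definition germ_kernel_pinfty : {pred subgroup G} :=
  fun f : subgroup G => `[< trivial_germ_pinfty (val f) >].

Definition germ_kernel_ninfty : {pred subgroup G} :=
  fun f : subgroup G => `[< trivial_germ_ninfty (val f) >].

Lemma homeopME (f g : homeop R) x : (f * g : homeop R) x = g (f x).
Proof. by []. Qed.

Lemma homeopK (f : homeop R) : cancel f (f^-1 : homeop R).
Proof. exact: (homeoK (homeop_val f)). Qed.

Lemma homeopVK (f : homeop R) : cancel (f^-1 : homeop R) f.
Proof. exact: (homeoVK (homeop_val f)). Qed.

Lemma homeop_lt (f : homeop R) : {mono f : x y / (x < y)%R}.
Proof.
have /asboolP hf := valP f.
by apply: leW_mono; apply: le_mono.
Qed.

Fact germ_kernel_pinfty_closed : group_closed germ_kernel_pinfty.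
Proof.
split=> [|f g /asboolP[r hf] /asboolP[s hg]]; first by apply/asboolP; exists 0%R.
apply/asboolP; exists (Num.max r s) => x; rewrite in_itv/= andbT gt_max.
move=> /andP[rx sx]; rewrite homeopME hf ?in_itv/= ?rx//.
by rewrite -[in LHS](hg x) ?homeopK// in_itv/= sx.
Qed.

Fact germ_kernel_ninfty_closed : group_closed germ_kernel_ninfty.
Proof.
split=> [|f g /asboolP[r hf] /asboolP[s hg]]; first by apply/asboolP; exists 0%R.
apply/asboolP; exists (Num.min r s) => x; rewrite in_itv/= lt_min.
move=> /andP[rx sx]; rewrite homeopME hf ?in_itv/= ?rx//.
by rewrite -[in LHS](hg x) ?homeopK// in_itv/= sx.
Qed.

Fact germ_kernel_pinfty_normal : is_normal germ_kernel_pinfty.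
Proof.
move=> f g /asboolP[r hf]; apply/asboolP; exists ((val g : homeop R) r) => x.
rewrite in_itv/= andbT => rx; rewrite !homeopME hf ?homeopVK//.
by rewrite in_itv/= andbT -(homeop_lt (val g)) homeopVK.
Qed.

Fact germ_kernel_ninfty_normal : is_normal germ_kernel_ninfty.
Proof.
move=> f g /asboolP[r hf]; apply/asboolP; exists ((val g : homeop R) r) => x.
rewrite in_itv/= => rx; rewrite !homeopME hf ?homeopVK//.
by rewrite in_itv/= -(homeop_lt (val g)) homeopVK.
Qed.

HB.instance Definition _ := isMulClosed.Build (subgroup G) germ_kernel_pinfty
  (group_closedM germ_kernel_pinfty_closed).
HB.instance Definition _ := isMul1Closed.Build (subgroup G) germ_kernel_pinfty
  germ_kernel_pinfty_closed.1.
HB.instance Definition _ := isInvClosed.Build (subgroup G) germ_kernel_pinfty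
  (group_closedV germ_kernel_pinfty_closed).

HB.instance Definition _ := isMulClosed.Build (subgroup G) germ_kernel_ninfty
  (group_closedM germ_kernel_ninfty_closed).
HB.instance Definition _ := isMul1Closed.Build (subgroup G) germ_kernel_ninfty
  germ_kernel_ninfty_closed.1.
HB.instance Definition _ := isInvClosed.Build (subgroup G) germ_kernel_ninfty
  (group_closedV germ_kernel_ninfty_closed).

Definition germ_group_pinfty : groupType :=
  quotient_group germ_kernel_pinfty_normal.

Definition germ_group_ninfty : groupType :=
  quotient_group germ_kernel_ninfty_normal.

Definition action_orbit (x : R) : set R := [set (g : homeop R) x | g in [set` G]].

Definition minimal_action : Prop := forall x : R, dense (action_orbit x).

Record coherent : Prop := Coherent {
  coherent_minimal : minimal_action;
  coherent_solvable_pinfty : is_solvable germ_group_pinfty;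
  coherent_solvable_ninfty : is_solvable germ_group_ninfty;
  coherent_pinfty : exists2 g : homeop R, g \in G &
    trivial_germ_ninfty g /\
    exists r : R, forall x, x \in `]r, +oo[ -> g x <> x;
  coherent_ninfty : exists2 g : homeop R, g \in G &
    trivial_germ_pinfty g /\
    exists s : R, forall x, x \in `]-oo, s[ -> g x <> x
}.

End Actions.

(* Main.v *)
Require Import Defs.
From mathcomp Require Import all_boot all_order all_algebra.
From mathcomp Require Import boolp classical_sets reals topology normedtype.
From mathcomp Require Import lra.

Set Implicit Arguments.
Unset Strict Implicit.
Unset Printing Implicit Defensive.

Import Order.TTheory GRing.Theory Num.Theory.
Import numFieldNormedType.Exports.

Local Open Scope classical_set_scope.
Local Open Scope ring_scope.

(** Both groups of the theorem are the same abstract group T acting on the line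
in two ways, so everything is about a pair of actions rho and sigma of T. Three
steps turn the equality of the underlying groups into a homeomorphism.

Dynamics. An element fixing a half-line (-oo, A) and fixing no point near +oo
has a last fixed point q, beyond which its powers push points arbitrarily far
to the right. Minimality moves q anywhere, which yields elements carrying any
compact interval into any open one ([compress]); applied to the interval between
A and q this gives elements that are the identity up to u and push v as far as
desired, for any u < v ([minimal_pushes_up]). With the mirror statement, an
interval can be shrunk into any neighbourhood of one of its points while that
point stays fixed ([compress_at]), and a commutator of two pushes has bounded
support; hence every point is moved by elements supported arbitrarily close to
it ([local_mover]).

Rubin's formula. In the presence of such local elements, disjointness of the
supports of f and g is expressible by the group law alone
([algebraically_disjointP]); so f and g have disjoint supports for rho if and
only if they do for sigma.

Matching points. Points x and y are linked when no element moving x under rho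
has a support disjoint from that of an element moving y under sigma. Every x is
linked to some y, obtained as a supremum of lower bounds of supports
([linked_exists]). If x were linked to y1 < y2, then pushes that are the
identity near y2 would fix x while spreading y1 densely over (y1, y2), so x
would be linked to a dense set of points there, although some element has
rho-support away from x and sigma-support inside (y1, y2) ([linked_not_lt]).
Being symmetric in rho and sigma, the link is the graph of a bijection; it is
equivariant, and therefore carries supports to supports. Supports form a base of
the topology, so the bijection is a homeomorphism. *)

(** * Actions on the line by increasing maps *)

(** As in the right actions of the theorem, the product g * h acts by g first.
Continuity comes for free: an increasing bijection of the line is a
homeomorphism. *)
Record line_action (R : realType) (T : groupType) := LineAction {
  act :> T -> R -> R;
  act1 : forall x, act 1%g x = x;
  actM : forall g h x, act (g * h)%g x = act h (act g x);
  act_homo : forall g, {homo act g : x y / x < y}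
}.

Section LineAction.
Variables (R : realType) (T : groupType) (rho : line_action R T).
Implicit Types (f g h : T) (x y z : R).

Lemma actK g : cancel (rho g) (rho g^-1%g).
Proof. by move=> x; rewrite -actM mulgV act1. Qed.

Lemma actVK g : cancel (rho g^-1%g) (rho g).
Proof. by move=> x; rewrite -actM mulVg act1. Qed.

Lemma act_inj g : injective (rho g).
Proof. exact: can_inj (actK g). Qed.

Lemma act_le g : {mono rho g : x y / x <= y}.
Proof. exact: le_mono (@act_homo _ _ rho g). Qed.

Lemma act_lt g : {mono rho g : x y / x < y}.
Proof. exact: leW_mono (act_le g). Qed.

Lemma act_fixV g x : rho g x = x -> rho g^-1%g x = x.
Proof. by move=> gx; rewrite -[in LHS]gx actK. Qed.

Lemma act_fixX g n x : rho g x = x -> rho (g ^+ n)%g x = x.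
Proof.
by move=> gx; elim: n => [|n IH]; rewrite ?expg0 ?act1// expgS actM gx.
Qed.

Lemma act_ltV g x y : (rho g^-1%g x < y) = (x < rho g y).
Proof. by rewrite -(act_lt g) actVK. Qed.

Lemma act_gtV g x y : (y < rho g^-1%g x) = (rho g y < x).
Proof. by rewrite -(act_lt g) actVK. Qed.

Definition supp g : set R := [set x | rho g x <> x].

Lemma suppN g x : ~ supp g x -> rho g x = x.
Proof. by move/contrapT. Qed.

Lemma supp_act g x : supp g x -> supp g (rho g x).
Proof. by move=> gx /act_inj. Qed.

Lemma suppV g : supp g^-1%g = supp g.
Proof.
by apply/seteqP; split=> x /= gx /act_fixV; rewrite ?invgK.
Qed.

Lemma supp_stable g (V : set R) x : supp g `<=` V -> V x -> V (rho g x).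
Proof.
move=> gV Vx; have [->//|gx] := pselect (rho g x = x).
by apply: gV; exact: supp_act.
Qed.

Lemma suppJ f g x : supp (f ^ g)%g (rho g x) <-> supp f x.
Proof.
rewrite /supp/= conjgE !actM actK; split=> [n e|n]; first by rewrite e in n.
by move/act_inj.
Qed.

Lemma nbhs_itvP x (V : set R) :
  nbhs x V <-> exists u v, u < x < v /\ forall z, u < z < v -> V z.
Proof.
split=> [/nbhs_ballP[e /= e0 eV]|[u [v [/andP[ux xv] uvV]]]].
  exists (x - e), (x + e); split=> [|z zV]; first by lra.
  by apply: eV; rewrite /ball/= ltr_norml; lra.
have : \forall z \near x, z \in `]u, v[.
  by apply: near_in_itvoo; rewrite in_itv/= ux.
by apply: filterS => z; rewrite in_itv/=; exact: uvV.
Qed.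

Lemma wander_up g x : x < rho g x -> exists2 V, nbhs x V &
  forall z n, V z -> ~ V (rho (g ^+ n.+1)%g z).
Proof.
move=> xgx; pose m := (x + rho g x) / 2.
have [xm mgx] : x < m /\ m < rho g x by rewrite /m; split; lra.
have mgm : m < rho g m by apply: lt_trans mgx _; rewrite act_lt.
exists [set z | rho g^-1%g m < z < m].
  by apply/nbhs_itvP; exists (rho g^-1%g m), m; rewrite act_ltV mgx xm.
move=> z n /= /andP[mz _]; apply/negP.
rewrite negb_and -!leNgt; apply/orP; right.
elim: n => [|n IH]; first by rewrite expg1 ltW// -act_ltV.
by rewrite expgSr actM (le_trans (ltW mgm))// act_le.
Qed.

(** A moved point has a neighbourhood that all positive iterates move off
itself: on the line a point pushed out on one side never comes back. *)
Lemma wander g x : supp g x -> exists2 V, nbhs x V &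
  forall z n, V z -> ~ V (rho (g ^+ n.+1)%g z).
Proof.
move=> /eqP; rewrite neq_lt => /orP[gx|]; last exact: wander_up.
have [|V Vx VN] := @wander_up g^-1%g x; first by rewrite act_gtV.
by exists V => // z n Vz Vgz; have := VN _ n Vgz; rewrite expVgn actK.
Qed.

Lemma supp_open g x : supp g x -> nbhs x (supp g).
Proof.
case/wander=> V Vx VN; apply: filterS Vx => z Vz gz.
by have := VN _ 0%N Vz; rewrite expg1 gz.
Qed.

(** A bounded forward orbit would have its supremum as a fixed point. *)
Lemma escape g x M : x < rho g x ->
  (forall s, x < s -> s <= M -> rho g s <> s) ->
  exists n, M < rho (g ^+ n)%g x.
Proof.
move=> xgx nofix; apply: contrapT => /forallNP leM.
have {}leM n : rho (g ^+ n)%g x <= M by rewrite leNgt; apply/negP.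
pose S := range (fun n => rho (g ^+ n)%g x).
have ubS : has_ubound S by exists M => _ [n _ <-].
have le_sup n : rho (g ^+ n)%g x <= sup S by apply: ub_le_sup => //; exists n.
have xs : x < sup S by apply: lt_le_trans (le_sup 1%N); rewrite expg1.
have S0 : S !=set0 by exists x, 0%N => //; rewrite expg0 act1.
apply: (nofix (sup S)) => //; first by apply: ge_sup => // _ [n _ <-].
apply/le_anti/andP; split.
  rewrite -(act_le g^-1%g) actK; apply: ge_sup => // _ [n _ <-].
  by rewrite -(act_le g) actVK -actM -expgSr.
apply: ge_sup => // _ [n _ <-].
apply: le_trans (_ : rho (g ^+ n.+1)%g x <= _).
  by rewrite expgS actM ltW// act_lt.
by rewrite expgSr actM act_le.
Qed.

(** * Pushing half-lines and compressing intervals *)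

Definition minimal := forall x u v, u < v -> exists g, u < rho g x < v.

Definition pusher := exists a A r,
  (forall x, x < A -> rho a x = x) /\ (forall x, r < x -> rho a x <> x).

Definition pushes_up := forall u v M, u < v ->
  exists g, (forall x, x <= u -> rho g x = x) /\ M < rho g v.

Definition faithful := forall g, (forall x, rho g x = x) -> g = 1%g.

Lemma last_fixpoint a A r : (forall x, x < A -> rho a x = x) ->
  (forall x, r < x -> rho a x <> x) ->
  exists q, rho a q = q /\ forall x, q < x -> rho a x <> x.
Proof.
move=> fixA nofix; pose S := [set x | rho a x = x].
have ubS : has_ubound S.
  by exists r => x ax; rewrite leNgt; apply/negP => /nofix.
have hS : has_sup S by split=> //; exists (A - 1); apply: fixA; lra.
exists (sup S); split=> [|x sx ax]; last by have := ub_le_sup ubS ax; lra.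
apply: suppN => /supp_open/nbhs_itvP[u [v [/andP[us sv] uvN]]].
have [z az uz] := sup_gt hS.1 us.
by apply: (uvN z _ az); rewrite uz (le_lt_trans _ sv)//; exact: ub_le_sup.
Qed.

(** Whether a moves v up or down, its powers of one sign push v up without
bound, since there is no fixed point beyond q to stop them. *)
Lemma push_beyond a q v M : rho a q = q ->
  (forall x, q < x -> rho a x <> x) -> q < v ->
  exists g, (forall x, rho a x = x -> rho g x = x) /\ M < rho g v.
Proof.
move=> aq nofix qv; have /eqP := nofix _ qv; rewrite neq_lt => /orP[av|va].
  have [||n Mn] := @escape a^-1%g v M; first by rewrite act_gtV.
    by move=> s vs _ /act_fixV; rewrite invgK; apply: nofix; exact: lt_trans vs.
  by exists (a^-1 ^+ n)%g; split=> // x /act_fixV; exact: act_fixX.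
have [|n Mn] := @escape a v M va.
  by move=> s vs _; apply: nofix; exact: lt_trans vs.
by exists (a ^+ n)%g; split=> // x; exact: act_fixX.
Qed.

Section Minimal.
Hypotheses (min : minimal) (push : pusher).

(* A power of the pushing element is conjugated by h, which moves its      *)
(* threshold A and its last fixed point q.                                 *)
Let push_at : exists A q, forall h w M, rho h q < w ->
  exists g, [/\ rho g (rho h q) = rho h q, M < rho g w &
    forall x, x < rho h A -> rho g x = x].
Proof.
have [a [A [r [fixA nofix]]]] := push.
have [q [aq qN]] := last_fixpoint fixA nofix.
exists A, q => h w M; rewrite -act_gtV => qw.
have [g [ag Mg]] := push_beyond (rho h^-1%g M) aq qN qw.
exists (g ^ h)%g; rewrite conjgE !actM; split.
- by rewrite actK ag.
- by rewrite -act_ltV.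
- by move=> x xA; rewrite !actM ag ?actVK// fixA// act_ltV.
Qed.

(** First push c beyond a fixed point of a push located in (u, v), using another
push whose fixed point lies below c; then contract everything towards that
fixed point with the inverse of the former push. *)
Lemma compress c d u v : u < v -> exists g, u < rho g c /\ rho g d < v.
Proof.
move=> uv; have [A [q pushq]] := push_at.
have [k /andP[ukq kqv]] := min q uv.
have [k' /andP[_ k'qc]] := min q (ltac:(lra) : c - 1 < c).
have [g [_ kqgc _]] := pushq k' c (rho k q) k'qc.
have [h [hkq gdh _]] := pushq k v (rho g d) kqv.
exists (g * h^-1)%g; rewrite !actM act_ltV; split=> //.
by apply: lt_trans ukq _; rewrite act_gtV hkq.
Qed.

(** Compressing the interval from A to q into (u, v) gives a push with both its
threshold and its last fixed point between u and v. *)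
Lemma minimal_pushes_up : pushes_up.
Proof.
move=> u v M uv; have [A [q pushq]] := push_at.
have [k [ukA kqv]] := compress A q uv.
have [g [_ Mg fixg]] := pushq k v M kqv.
by exists g; split=> // x xu; apply: fixg; exact: le_lt_trans ukA.
Qed.

End Minimal.
End LineAction.

(** The conjugate by x |-> - x, through which facts about +oo become facts
about -oo. *)
Section Mirror.
Variables (R : realType) (T : groupType) (rho : line_action R T).

Definition mirror : line_action R T.
Proof.
refine (@LineAction R T (fun g x => - rho g (- x)) _ _ _).
- by move=> x; rewrite act1 opprK.
- by move=> g h x; rewrite opprK actM.
- by move=> g x y xy; rewrite ltrN2 act_lt ltrN2.
Defined.

Lemma minimal_mirror : minimal rho -> minimal mirror.
Proof.
move=> min x u v uv; have [g guv] := min (- x) (- v) (- u) ltac:(lra).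
by exists g => /=; lra.
Qed.

Definition pushes_down := forall u v M, u < v ->
  exists g, (forall x, v <= x -> rho g x = x) /\ rho g u < M.

Lemma mirror_pushes_up : pushes_up mirror -> pushes_down.
Proof.
move=> up u v M uv; have [g [fixg Mg]] := up (- v) (- u) (- M) ltac:(lra).
exists g; split=> [x vx|]; last by move: Mg; rewrite /= opprK; lra.
by apply: oppr_inj; rewrite -[in LHS](opprK x); apply: fixg; lra.
Qed.

End Mirror.

(** * Elements with small support *)

Record compressing (R : realType) (T : groupType) (rho : line_action R T) :
    Prop := Compressing {
  compressing_minimal : minimal rho;
  compressing_up : pushes_up rho;
  compressing_down : pushes_down rho;
  compressing_faithful : faithful rho
}.

Section Compressing.
Variables (R : realType) (T : groupType) (rho : line_action R T).
Hypothesis rhoC : compressing rho.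
Implicit Types (f g h k : T) (x y z : R) (V : set R).

(** The inverse of a push fixing (-oo, x] brings d close to x, that of a push
fixing [x, +oo) brings c close to x, and they do not interfere. *)
Lemma compress_at x u v c d : u < x < v -> c < x < d ->
  exists g, [/\ rho g x = x, u < rho g c & rho g d < v].
Proof.
move=> /andP[ux xv] /andP[cx xd].
have [a [fixa dav]] := compressing_up rhoC d xv.
have [b [fixb buc]] := compressing_down rhoC c ux.
have fixaV y : y <= x -> rho a^-1%g y = y by move=> /fixa/act_fixV.
have fixbV y : x <= y -> rho b^-1%g y = y by move=> /fixb/act_fixV.
exists (a^-1 * b^-1)%g; rewrite !actM; split.
- by rewrite fixaV ?fixbV.
- by rewrite fixaV ?act_gtV// ltW.
- by rewrite fixbV ?act_ltV// ltW// act_gtV fixa.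
Qed.

(** If a pushes to the right and b to the left, the commutator of the inverse of
a with b has bounded support; it moves x as b does, because a throws x into the
region where b is the identity. *)
Lemma bounded_supp x : exists f lo hi,
  supp rho f x /\ supp rho f `<=` [set z | lo < z < hi].
Proof.
pose hi := x + 1.
have [a [fixa hia]] := compressing_up rhoC hi (ltac:(lra) : x - 1 < x).
have xhi : x < hi by rewrite /hi; lra.
have [b [fixb bx]] := compressing_down rhoC x xhi.
have fixbV z : hi <= z -> rho b^-1%g z = z by move=> hz; apply/act_fixV/fixb.
pose f := (a * b^-1 * a^-1 * b)%g.
have fE z : rho f z = rho b (rho a^-1%g (rho b^-1%g (rho a z))).
  by rewrite !actM.
(* Nothing moves below both x - 1 and its image by b, nor above hi; the extra *)
(* 1 makes the bounds strict.                                                 *)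
exists f, (Num.min (x - 1) (rho b (x - 1)) - 1), (hi + 1); split=> [|z fz].
  by rewrite /supp/= fE fixbV ?actK ?ltW// => e; rewrite e ltxx in bx.
apply/andP; split; rewrite ltNge; apply/negP => ?; apply: fz; rewrite fE.
  have /andP[zx zb] : (z < x - 1) && (z < rho b (x - 1)).
    by rewrite -lt_min; lra.
  by rewrite (fixa z) ?ltW// act_fixV ?actVK// fixa// ltW// act_ltV.
have hz : hi <= z by lra.
have haz : hi <= rho a z.
  by apply: ltW; apply: lt_trans hia _; rewrite act_lt (lt_le_trans xhi).
by rewrite fixbV// actK fixb.
Qed.

(** A conjugate of a bounded element moving x, by an element fixing x that
shrinks the bounded support into V. *)
Lemma local_mover x V : nbhs x V -> exists2 f, supp rho f x & supp rho f `<=` V.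
Proof.
move=> /nbhs_itvP[u [v [uxv uvV]]].
have [f [lo [hi [fx flohi]]]] := bounded_supp x.
have [g [gx ug gv]] := compress_at uxv (flohi _ fx).
exists (f ^ g)%g => [|z]; first by rewrite -gx suppJ.
rewrite -(actVK rho g z) suppJ => /flohi/andP[loz zhi]; apply: uvV.
by rewrite (lt_trans ug) ?(lt_trans _ gv)// act_lt.
Qed.

(** * Rubin's algebraic description of disjoint supports *)

Definition disjoint_supp f g := forall x, supp rho f x -> ~ supp rho g x.

Lemma faithful_act f g : rho f =1 rho g -> f = g.
Proof.
move=> fg; apply/divg1_eq/(compressing_faithful rhoC) => x.
by rewrite actM fg actK.
Qed.

Lemma nontrivial_supp f : f <> 1%g -> exists x, supp rho f x.
Proof.
move=> f1; apply: contrapT => /forallNP nf; apply: f1.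
by apply: (compressing_faithful rhoC) => x; apply: suppN.
Qed.

Lemma disjoint_commute f g : disjoint_supp f g -> commute f g.
Proof.
move=> fg; apply: faithful_act => x; rewrite !actM.
have [fx|fx] := pselect (supp rho f x).
  by rewrite (suppN (fg _ fx)) (suppN (fg _ (supp_act fx))).
rewrite (suppN fx); have [gx|gx] := pselect (supp rho g x).
  by rewrite [RHS]suppN// => /fg; apply; exact: supp_act.
by rewrite (suppN gx) (suppN fx).
Qed.

Lemma suppR f h x : supp rho [~ f, h]%g x ->
  supp rho h x \/ supp rho h (rho f^-1%g x).
Proof.
move=> fhx; have [|hx] := pselect (supp rho h x); [by left|right=> hfx].
by apply: fhx; rewrite commgEl conjgE !actM (act_fixV hfx) actVK suppN.
Qed.

(** The formula mentions only the group law, hence has the same meaning in every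
action. It says that the centraliser of g is rich wherever f moves something:
each h interacting with f can be cut down, by two commutators with elements
of the centraliser, to a nontrivial element of it. *)
Definition algebraically_disjoint f g := forall h, ~ commute f h ->
  exists f1 f2, [/\ commute f1 g, commute f2 g, commute [~ f1, [~ f2, h]]%g g
    & [~ f1, [~ f2, h]]%g <> 1%g].

(** Near a point moved by f and h, take f2 and then f1 supported in a set V that
h displaces and f moves. On V the commutator [~ f2, h] is the inverse of f2,
since the conjugate of f2 by h lives outside V; so the double commutator is
[~ f1, f2^-1], supported in V, where g is trivial. It is nontrivial because
the support of f1 is displaced by f2. *)
Lemma disjoint_algebraically f g : disjoint_supp f g ->
  algebraically_disjoint f g.
Proof.
move=> fg h fh.
have [x fx hx] : exists2 x, supp rho f x & supp rho h x.
  apply: contrapT => nx; apply/fh/disjoint_commute => x fx hx.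
  by apply: nx; exists x.
have [V0 V0x hV] := wander hx.
pose V := V0 `&` supp rho f.
have Vx : nbhs x V by apply: filterI => //; exact: supp_open.
have [f2 f2x f2V] := local_mover Vx.
have [W0 W0x f2W] := wander f2x.
have [f1 f1x f1VW] := local_mover (filterI Vx W0x).
have f1V : supp rho f1 `<=` V by move=> z /f1VW[].
have commg k : supp rho k `<=` V -> commute k g.
  by move=> kV; apply: disjoint_commute => z /kV[_ /fg].
pose c := [~ f2, h]%g.
have cE z : V z -> rho c z = rho f2^-1%g z.
  move=> Vz; have Vf2z : V (rho f2^-1%g z).
    by apply: supp_stable Vz; rewrite suppV.
  rewrite /c commgEl conjgE !actM; set y := rho f2^-1%g z in Vf2z *.
  rewrite (suppN (_ : ~ supp rho f2 (rho h^-1%g y))) ?actVK//.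
  move=> /f2V[V0hy _]; apply: (hV _ 0%N V0hy).
  by rewrite expg1 actVK; case: Vf2z.
have cVE z : V z -> rho c^-1%g z = rho f2 z.
  move=> Vz; apply: (@act_inj _ _ rho c); rewrite actVK cE ?actK//.
  exact: supp_stable Vz.
have cV z : V (rho c^-1%g z) -> V z.
  move=> Vcz; rewrite -(actVK rho c z) cE//.
  by apply: supp_stable Vcz; rewrite suppV.
have eE z : rho [~ f1, c]%g z = rho c (rho f1 (rho c^-1%g (rho f1^-1%g z))).
  by rewrite commgEl conjgE !actM.
exists f1, f2; split; [exact: commg|exact: commg| |].
  apply: commg => z ez; apply: contrapT => Vz; apply: ez; rewrite eE.
  rewrite (suppN (_ : ~ supp rho f1^-1%g z)); last by rewrite suppV => /f1V.
  by rewrite (suppN (_ : ~ supp rho f1 _)) ?actVK// => /f1V/cV.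
move=> e1; have : supp rho f1^-1%g x by rewrite suppV.
apply; have := eE x; rewrite -/c e1 act1 => {2}->.
have [Vf1x W0f1x] : (V `&` W0) (rho f1^-1%g x).
  by apply: supp_stable; [rewrite suppV|split=> //; exact: nbhs_singleton].
rewrite (cVE _ Vf1x) (suppN (_ : ~ supp rho f1 _)).
  by rewrite -cVE// actVK.
by move=> /f1VW[_]; have := f2W _ 0%N W0f1x; rewrite expg1.
Qed.

(** For the direct implication, if f and g both move x, choose h supported in a
set that f and g displace; h does not commute with f. For any f1 and f2
commuting with g, the double commutator e is supported in four translates of
the support of h, by products of f1 and f2. The iterates of a point under g meet
each translate at most once, as g commutes with f1 and f2, yet those of a point
moved by e stay in the support of e when e commutes with g. *)
Lemma algebraically_disjointP f g :
  algebraically_disjoint f g <-> disjoint_supp f g.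
Proof.
split; last exact: disjoint_algebraically.
move=> fg x fx gx.
have [Vf Vfx fV] := wander fx; have [Vg Vgx gV] := wander gx.
have [h hx hV] := local_mover (filterI Vfx Vgx).
have [|f1 [f2 [f1g f2g eg e1]]] := fg h.
  move=> fh; have : rho (f * h)%g x = rho (h * f)%g x by rewrite fh.
  rewrite !actM => e; apply: hx.
  suff hfx : ~ supp rho h (rho f x).
    by apply: (@act_inj _ _ rho f); rewrite -e suppN.
  by move=> /hV[+ _]; have := fV x 0%N (nbhs_singleton Vfx); rewrite expg1.
have [z ez] := nontrivial_supp e1.
have leave w : exists N, forall n, (N <= n)%N ->
    ~ supp rho h (rho (g ^+ n)%g w).
  have [[m hm]|/forallNP nm] :=
    pselect (exists m, supp rho h (rho (g ^+ m)%g w)).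
    exists m.+1 => n mn /hV[_]; rewrite -(subnKC mn) addSnnS expgnDr actM.
    by apply: gV; case: (hV _ hm).
  by exists 0%N => n _; exact: nm.
have gcomm k n w : commute k g ->
    rho k^-1%g (rho (g ^+ n)%g w) = rho (g ^+ n)%g (rho k^-1%g w).
  move=> kg; rewrite -!actM; congr (rho _ _).
  by apply/commute_sym/commuteX/commute_sym/commuteV/commute_sym.
have [N0 H0] := leave z.
have [N1 H1] := leave (rho f1^-1%g z).
have [N2 H2] := leave (rho f2^-1%g z).
have [N3 H3] := leave (rho f2^-1%g (rho f1^-1%g z)).
pose n := maxn (maxn N0 N1) (maxn N2 N3).
have : supp rho [~ f1, [~ f2, h]]%g (rho (g ^+ n)%g z).
  move=> en; apply: ez; apply: (@act_inj _ _ rho (g ^+ n)%g).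
  by rewrite -[RHS]en -!actM (commuteX n eg).
by move=> /suppR[|] /suppR[|]; rewrite ?gcomm//;
  [apply: H0|apply: H2|apply: H1|apply: H3]; rewrite /n !leq_max leqnn ?orbT.
Qed.

End Compressing.

(** * Linking the points of two actions *)

Section TwoActions.
Variables (R : realType) (T : groupType).
Implicit Types (rho sigma : line_action R T) (f g h k : T) (x y z : R).

Lemma disjoint_supp_transfer rho sigma f g :
    compressing rho -> compressing sigma ->
  disjoint_supp rho f g -> disjoint_supp sigma f g.
Proof.
by move=> rhoC sigmaC; rewrite -!algebraically_disjointP.
Qed.

Definition linked rho sigma x y := forall f k,
  supp rho f x -> supp sigma k y -> ~ disjoint_supp rho f k.

(** Disjointness of supports has the same meaning in both actions, so exchanging
the actions transposes the relation. *)
Lemma linked_sym rho sigma x y : compressing rho -> compressing sigma ->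
  linked rho sigma x y -> linked sigma rho y x.
Proof.
move=> rhoC sigmaC xy f k fy kx fk; apply: (xy k f) => //.
by apply: (disjoint_supp_transfer sigmaC rhoC) => z kz /fk.
Qed.

Lemma linked_act rho sigma g x y :
  linked rho sigma x y -> linked rho sigma (rho g x) (sigma g y).
Proof.
move=> xy f k; rewrite -{1}(conjgKV g f) -{1}(conjgKV g k) !suppJ => fx ky fk.
apply: (xy _ _ fx ky) => z.
rewrite -(suppJ rho (f ^ g^-1)%g g) -(suppJ rho (k ^ g^-1)%g g) !conjgKV.
exact: fk.
Qed.

Variables rho sigma : line_action R T.
Hypotheses (rhoC : compressing rho) (sigmaC : compressing sigma).

(** Inclusion of supports is inherited by sigma up to closure: an element k
supported in the interior of the sigma-fixed set of f is disjoint from f, hence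
from g. *)
Lemma supp_sub_transfer f g y : supp rho g `<=` supp rho f ->
  nbhs y (~` supp sigma f) -> ~ supp sigma g y.
Proof.
move=> gf fy gy; have [k ky kf] := local_mover sigmaC fy.
have fk : disjoint_supp sigma f k by move=> z fz /kf.
have := disjoint_supp_transfer sigmaC rhoC fk.
move=> {}fk; apply: (disjoint_supp_transfer rhoC sigmaC _ gy ky) => z /gf.
exact: fk.
Qed.

(** The sigma-supports of the elements moving x under rho form, up to closure, a
filter base which contains a bounded set. The supremum of the lower bounds of
these supports lies in the closure of all of them. *)
Lemma linked_exists x : exists y, linked rho sigma x y.
Proof.
have [f0 [lo [hi [f0x f0lohi]]]] : exists f lo hi,
    supp rho f x /\ supp sigma f `<=` [set z | lo < z < hi].
  have [f [lo [hi [f0 flohi]]]] := bounded_supp sigmaC 0.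
  have [|x0 fx0] := @nontrivial_supp _ _ rho rhoC f.
    by move=> f1; apply: f0; rewrite f1 act1.
  have /nbhs_itvP[u [v [/andP[ux0 x0v] uvf]]] := supp_open fx0.
  have [g guv] := compressing_minimal rhoC x (lt_trans ux0 x0v).
  (* Minimality moves x into the rho-support of f, and conjugation keeps the *)
  (* sigma-support bounded.                                                 *)
  exists (f ^ g^-1)%g, (sigma g^-1%g lo), (sigma g^-1%g hi); split.
    by rewrite -(actK rho g x) suppJ; exact: uvf.
  move=> z; rewrite -(actK sigma g z) suppJ => /flohi.
  by rewrite /= !act_lt.
pose below f := [set t | forall z, supp sigma f z -> t <= z].
have below_sub f g t : supp rho g `<=` supp rho f -> below f t -> below g t.
  move=> gf ft z gz; rewrite leNgt; apply/negP => zt.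
  apply: (supp_sub_transfer gf) gz; apply/nbhs_itvP.
  exists (z - 1), t; split=> [|w /andP[_ wt] /ft]; first by lra.
  by rewrite leNgt wt.
have refine f g : supp rho f x -> supp rho g x -> exists h,
    [/\ supp rho h x, supp rho h `<=` supp rho f & supp rho h `<=` supp rho g].
  move=> fx gx.
  have [h hx hfg] := local_mover rhoC (filterI (supp_open fx) (supp_open gx)).
  by exists h; split=> // z /hfg[].
pose S := [set t | exists2 f, supp rho f x & below f t].
have S0 : S !=set0.
  by exists lo, f0 => // z /f0lohi/andP[/ltW].
have ubS : has_ubound S.
  exists hi => t [f fx ft]; have [h [hx hf hf0]] := refine _ _ fx f0x.
  have [|z hz] := @nontrivial_supp _ _ sigma sigmaC h.
    by move=> h1; apply: hx; rewrite h1 act1.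
  apply: le_trans (below_sub _ _ _ hf ft z hz) _.
  rewrite leNgt; apply/negP => hiz.
  apply: (supp_sub_transfer hf0) hz; apply/nbhs_itvP.
  exists hi, (z + 1); split=> [|w /andP[hiw _] /f0lohi]; first by lra.
  by move=> /andP[_]; rewrite ltNge ltW.
exists (sup S) => f k fx ky fk.
have /nbhs_itvP[u [v [/andP[usup supv] uvk]]] := supp_open ky.
have [t [g gx gt] ut] := sup_gt S0 usup.
have [h [hx hf hg]] := refine _ _ fx gx.
(* A common refinement h of f and g has sigma-support above u, because of g,  *)
(* and off (u, v), because f is disjoint from k: v is one more lower bound.   *)
have /(ub_le_sup ubS) : S v; last by rewrite leNgt supv.
exists h => // z hz; rewrite leNgt; apply/negP => zv.
have tz := below_sub _ _ _ hg gt z hz.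
apply: (supp_sub_transfer hf) hz; apply/nbhs_itvP; exists u, v; split.
  by rewrite zv (lt_le_trans ut).
move=> w /uvk kw fw.
exact: (disjoint_supp_transfer rhoC sigmaC fk fw kw).
Qed.

Lemma linked_fix b x y : linked rho sigma x y ->
  nbhs y (~` supp sigma b) -> rho b x = x.
Proof.
move=> xy by_; apply: suppN => bx; have [k ky kb] := local_mover sigmaC by_.
apply: (xy b k) => //; apply: (disjoint_supp_transfer sigmaC rhoC) => z bz.
by move=> /kb.
Qed.

End TwoActions.

Section Conjugacy.
Variables (R : realType) (T : groupType).

(** Since some push fixing a neighbourhood of y2, hence x, carries y1 into any
given subinterval of (y1, y2), x is linked to a dense set of points there. But
take j with sigma-support in (p, q), inside (y1, y2), and i with rho-support
inside that of j and away from x: the sigma-support of i is a nonempty subset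
of [p, q], and no point in it can be linked to x. *)
Lemma linked_not_lt (rho sigma : line_action R T) x y1 y2 :
    compressing rho -> compressing sigma ->
  linked rho sigma x y1 -> linked rho sigma x y2 -> ~ (y1 < y2).
Proof.
move=> rhoC sigmaC xy1 xy2 y12.
have dense_linked u v : y1 <= u -> u < v -> v < y2 ->
    exists2 y, u < y < v & linked rho sigma x y.
  move=> y1u uv vy2; have [b [fixb bu]] := compressing_down sigmaC y1 uv.
  exists (sigma b^-1%g y1); first by rewrite act_gtV act_ltV bu fixb//; lra.
  suff bx : rho b x = x by rewrite -(act_fixV bx); exact: linked_act.
  apply: (linked_fix rhoC sigmaC xy2); apply/nbhs_itvP; exists v, (y2 + 1).
  split=> [|z /andP[vz _]]; first by lra.
  by apply; apply: fixb; rewrite ltW.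
pose p := y1 + (y2 - y1) / 3; pose q := y1 + 2 * (y2 - y1) / 3.
have [j jm jpq] : exists2 j, supp sigma j ((p + q) / 2) &
    supp sigma j `<=` [set z | p < z < q].
  apply: (local_mover sigmaC); apply/nbhs_itvP; exists p, q; split=> //.
  by rewrite /p /q; lra.
have [|x0 jx0] := @nontrivial_supp _ _ rho rhoC j.
  by move=> j1; apply: jm; rewrite j1 act1.
have [x1 jx1 x1x] : exists2 x1, supp rho j x1 & x1 <> x.
  have [x0x|] := pselect (x0 = x); last by exists x0.
  by exists (rho j x0); [exact: supp_act|rewrite -x0x].
have [A [B [Ax1 Bx AB]]] : exists A B : set R,
    [/\ nbhs x1 A, nbhs x B & forall z, A z -> ~ B z].
  pose m := (x + x1) / 2.
  have [xx1|x1x'|] := ltgtP x x1; last by move/esym.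
    exists [set z | m < z], [set z | z < m]; split.
    - apply/nbhs_itvP; exists m, (x1 + 1); split=> [|z /andP[]//].
      by rewrite /m; lra.
    - apply/nbhs_itvP; exists (x - 1), m; split=> [|z /andP[]//].
      by rewrite /m; lra.
    - by move=> z /= mz; rewrite ltNge ltW.
  exists [set z | z < m], [set z | m < z]; split.
  - apply/nbhs_itvP; exists (x1 - 1), m; split=> [|z /andP[]//].
    by rewrite /m; lra.
  - apply/nbhs_itvP; exists m, (x + 1); split=> [|z /andP[]//].
    by rewrite /m; lra.
  - by move=> z /= mz; rewrite ltNge ltW.
have [i ix1 ijA] := local_mover rhoC (filterI (supp_open jx1) Ax1).
have [|z iz] := @nontrivial_supp _ _ sigma sigmaC i.
  by move=> i1; apply: ix1; rewrite i1 act1.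
have [y1z zy2] : y1 < z /\ z < y2.
  have ij : supp rho i `<=` supp rho j by move=> w /ijA[].
  split; rewrite ltNge; apply/negP => zy;
    apply: (supp_sub_transfer rhoC sigmaC ij) iz.
    apply/nbhs_itvP; exists (z - 1), p; split=> [|w /andP[_ wp] /jpq/andP[]].
      by rewrite /p; lra.
    by rewrite ltNge ltW.
  apply/nbhs_itvP; exists q, (z + 1); split=> [|w /andP[qw _] /jpq/andP[_]].
    by rewrite /q; lra.
  by rewrite ltNge ltW.
have /nbhs_itvP[u [v [/andP[uz zv] uvi]]] := supp_open iz.
pose y3 := (z + y2) / 2.
have [zy3 y3y2] : z < y3 /\ y3 < y2 by rewrite /y3; split; lra.
have [|||y /andP[]] := dense_linked (Num.max u y1) (Num.min v y3).
- by rewrite le_max lexx orbT.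
- by rewrite gt_max !lt_min (lt_trans uz) ?(lt_trans y1z) ?(lt_trans uz).
- by rewrite gt_min y3y2 orbT.
rewrite gt_max lt_min => /andP[uy _] /andP[yv _] xy.
have [f fx fB] := local_mover rhoC Bx.
apply: (xy f i fx); first by apply: uvi; rewrite uy.
by move=> w /fB Bw /ijA[_ /AB].
Qed.

Lemma linked_unique (rho sigma : line_action R T) x y1 y2 :
    compressing rho -> compressing sigma ->
  linked rho sigma x y1 -> linked rho sigma x y2 -> y1 = y2.
Proof.
move=> rhoC sigmaC xy1 xy2; case: (ltgtP y1 y2) => // y12.
  by case: (linked_not_lt rhoC sigmaC xy1 xy2).
by case: (linked_not_lt rhoC sigmaC xy2 xy1).
Qed.

(** Equivariance and injectivity make the preimage of a sigma-support the
rho-support of the same element, and small supports form a base. *)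
Lemma link_continuous (rho sigma : line_action R T) (phi : R -> R) :
    compressing rho -> compressing sigma ->
    injective phi -> (forall g x, phi (rho g x) = sigma g (phi x)) ->
  continuous phi.
Proof.
move=> rhoC sigmaC phi_inj phiE x V /= Vx.
have [k kx kV] := local_mover sigmaC Vx.
have : supp rho k x by move=> kx'; apply: kx; rewrite -phiE kx'.
move=> /supp_open; apply: filterS => z kz; apply: kV.
by rewrite /supp/= -phiE => /phi_inj.
Qed.

Theorem compressing_conjugate (rho sigma : line_action R T) :
    compressing rho -> compressing sigma ->
  exists2 phi : R -> R, is_homeomorphism phi &
    forall g x, phi (rho g x) = sigma g (phi x).
Proof.
move=> rhoC sigmaC.
have [phi phiP] := choice (linked_exists rhoC sigmaC).
have [psi psiP] := choice (linked_exists sigmaC rhoC).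
have phiK : cancel phi psi.
  move=> x; apply: (linked_unique sigmaC rhoC (psiP _)).
  exact: linked_sym.
have psiK : cancel psi phi.
  move=> x; apply: (linked_unique rhoC sigmaC (phiP _)).
  exact: linked_sym.
have phiE g x : phi (rho g x) = sigma g (phi x).
  by apply: (linked_unique rhoC sigmaC (phiP _)); exact: linked_act.
exists phi => //; exists psi; split=> //.
  exact: link_continuous (can_inj phiK) phiE.
apply: (link_continuous sigmaC rhoC (can_inj psiK)) => g x.
by apply: (can_inj phiK); rewrite phiE !psiK.
Qed.

End Conjugacy.

(** * Coherent actions *)

Section Coherent.
Variables (R : realType) (T : groupType) (G : groupClosed (homeop R)).
Variable nu : {multiplicative T -> subgroup G}.

Lemma multiplicative1 : nu 1%g = 1%g.
Proof. by apply: (@mulgI _ (nu 1%g)); rewrite -gmulfM !mulg1. Qed.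

(** Taking for nu the identity and the given isomorphism provides the two
actions to be compared. *)
Definition subgroup_action : line_action R T.
Proof.
refine (@LineAction R T (fun g => subgroup_homeo (nu g)) _ _ _).
- by move=> x; rewrite multiplicative1.
- by move=> g h x; rewrite gmulfM.
- by move=> g x y xy; rewrite /subgroup_homeo homeop_lt.
Defined.

Lemma coherent_compressing : coherent G -> bijective nu ->
  compressing subgroup_action.
Proof.
move=> [min _ _ [a Ga [[A fixA] [r nofix]]] [b Gb [[B fixB] [s nofixB]]]].
move=> [mu nuK muK].
have liftG (g : homeop R) : g \in G ->
    exists t, forall x, subgroup_homeo (nu t) x = g x.
  by move=> Gg; exists (mu (exist _ g Gg)) => x; rewrite muK.
have minG : minimal subgroup_action.
  move=> x u v uv.
  have [y [/= uyv [g /= Gg gxy]]] : `]u, v[ `&` action_orbit G x !=set0.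
    apply: min; first by exists ((u + v) / 2); rewrite /= in_itv/=; lra.
    exact: interval_open.
  by have [t tE] := liftG g Gg; exists t; rewrite /= tE gxy;
    rewrite in_itv in uyv.
split=> //.
- apply: minimal_pushes_up => //.
  have [t tE] := liftG a Ga; exists t, A, r.
  by split=> x; rewrite /= tE => ?; [apply: fixA|apply: nofix];
    rewrite in_itv/= ?andbT.
- apply/mirror_pushes_up/minimal_pushes_up; first exact: minimal_mirror.
  have [t tE] := liftG b Gb; exists t, (- B), (- s); split=> x ?.
    by rewrite /= tE fixB ?opprK// in_itv/= andbT; lra.
  rewrite /= tE => /eqP; rewrite eqr_oppLR => /eqP.
  by apply: nofixB; rewrite in_itv/=; lra.
- move=> g g1; apply: (can_inj nuK); rewrite multiplicative1.
  by apply/val_inj/val_inj/homeoP.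
Qed.

End Coherent.

Theorem theorem1p2 (R : realType) (G H : groupClosed (homeop R))
  (cohG : coherent G) (cohH : coherent H)
  (nu : {multiplicative subgroup G -> subgroup H}) (nu_iso : bijective nu) :
  exists phi : homeo R, forall f : subgroup G,
    subgroup_homeo (nu f) = (phi^-1 * subgroup_homeo f * phi)%g.
Proof.
have rhoC := @coherent_compressing R _ G idfun cohG ltac:(by exists idfun).
have sigmaC := coherent_compressing cohH nu_iso.
have [phi hphi phiE] := compressing_conjugate rhoC sigmaC.
pose p := homeo_mk hphi; exists p => f; apply/homeoP => y.
rewrite !homeoME -[in LHS](homeoVK p y).
exact/esym/phiE.
Qed.
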